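(* Let $f:\mathbb{R}^n\to\mathbb{R}$ be continuously differentiable, let $\varphi:\mathbb{R}^n\to(-\infty,\infty]$ be convex, lower semicontinuous and proper, and put $\psi=f+\varphi$. Assume that $\nabla f$ is Lipschitz continuous on $\mathrm{dom}(\varphi)$ with modulus $L$, and that $\psi$ is bounded from below on $\mathrm{dom}(\partial\varphi)$. Let $\{z_k\}$ be generated by the Algorithm described in the context, with $x_k=\mathrm{prox}_{\lambda\varphi}(z_k)$. Then the Algorithm either terminates after finitely many steps, or we have $$\lim_{k\to\infty}\chi(z_k)=0\qquad\text{and}\qquad \sum_{k=0}^\infty \nu_k\|x_{k+1}-x_k\|^2<\infty .$$
   Context: Notation. $\lambda>0$ is fixed; $\mathrm{prox}_{\lambda\varphi}(z)=\mathrm{argmin}_{y}\,\varphi(y)+\frac1{2\lambda}\|z-y\|^2$; $F^\lambda_{\mathrm{nor}}(z)=\nabla f(\mathrm{prox}_{\lambda\varphi}(z))+\lambda^{-1}(z-\mathrm{prox}_{\lambda\varphi}(z))$ (normal map); $\chi(z)=\|F^\lambda_{\mathrm{nor}}(z)\|$; merit function $H(\tau,z)=\psi(\mathrm{prox}_{\lambda\varphi}(z))+\frac{\tau\lambda}{2}\|F^\lambda_{\mathrm{nor}}(z)\|^2$. $\partial\,\mathrm{prox}_{\lambda\varphi}(z)$ is Clarke's generalized Jacobian. CG method. For a symmetric matrix $S\in\mathbb{R}^{n\times n}$, $g\in\mathbb{R}^n$, $\epsilon\ge0$, CG$(S,g,\epsilon)$ for the system $S\tilde q=-g$ is: set $q_0=0$,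 $r_0=g$, $p_0=-g$. If $\|r_0\|\le\epsilon$ return $q_0$. For $i=0,1,\dots,n-1$: if $\langle p_i,Sp_i\rangle\le 0$, return $p_0$ when $i=0$ and $q_i$ when $i\ne0$; otherwise set $\alpha_i=\|r_i\|^2/\langle p_i,Sp_i\rangle$, $q_{i+1}=q_i+\alpha_ip_i$, $r_{i+1}=r_i+\alpha_iSp_i$; if $\|r_{i+1}\|\le\epsilon$ return $q_{i+1}$; otherwise set $\beta_{i+1}=\|r_{i+1}\|^2/\|r_i\|^2$, $p_{i+1}=-r_{i+1}+\beta_{i+1}p_i$. Algorithm. Parameters: $z_0\in\mathbb{R}^n$, symmetric $B_0$, $\bar L,\lambda,\tau_{-1}>0$, $\sigma,\rho,\gamma,\nu\in(0,1)$, $q,\eta>0$, tolerances $\epsilon_k\ge0$, and numbers $\nu_k\in(0,\nu]$. For $k=0,1,\dots$, while $F^\lambda_{\mathrm{nor}}(z_k)\neq0$ (otherwise terminate): (1) Choose $D_k\in\partial\,\mathrm{prox}_{\lambda\varphi}(z_k)$ and set $M_k=B_kD_k+\frac1\lambda(I-D_k)$. (2) Let $q_k$ be the output of CG$(D_kM_k,\,D_kF^\lambda_{\mathrm{nor}}(z_k),\,\epsilon_k)$; set $d_k=-F^\lambda_{\mathrm{nor}}(z_k)$ and $e_k=q_k/\lambda-M_kq_k$. (3) With $b_k=(k\ln^2(k+1))^q$ and $\eta_k=\min\{b_k\chi(z_k)^q,\eta\}$, test whether $\eta_k\|e_k\|\le\chi(z_k)$. If the test holds, set $s_k(\alpha)=\alpha\lambda(d_k+\alpha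 e_k)$ (second-order case); otherwise set $s_k(\alpha)=\alpha\lambda d_k$ (first-order case). (4) Linesearch: for $t=0,1,2,\dots$ put $\alpha=\rho^t$, $x_k=\mathrm{prox}_{\lambda\varphi}(z_k)$, $p_\alpha=\mathrm{prox}_{\lambda\varphi}(z_k+s_k(\alpha))$, $U_\alpha=f(p_\alpha)-f(x_k)-\langle\nabla f(x_k),p_\alpha-x_k\rangle$, $V_\alpha=\|p_\alpha-x_k\|$, $W_\alpha=\|\nabla f(p_\alpha)-\nabla f(x_k)\|$; set $L_k^{(t)}=\max\{2U_\alpha/V_\alpha^2,\,W_\alpha/V_\alpha\}$ if $V_\alpha\ne0$ and $L_k^{(t)}=\bar L$ otherwise; set $\tau_k^{(t)}=\min\{\frac{2\gamma(1-\nu_k)}{(L_k^{(t)})^2\lambda^2+2},\tau_{k-1}\}$. Stop at the first $t$ for which $$H(\tau_k^{(t)},z_k+s_k(\alpha))-H(\tau_k^{(t)},z_k)\le-\frac{\sigma\lambda\tau_k^{(t)}\alpha}{2}\chi(z_k)^2-\frac{\nu_k}{\lambda\alpha}\|p_\alpha-x_k\|^2,$$ and then set $\alpha_k=\alpha$, $\tau_k=\tau_k^{(t)}$, $L_k=L_k^{(t)}$. (5) Set $z_{k+1}=z_k+s_k(\alpha_k)$ and choose a symmetric matrix $B_{k+1}$ (an approximation of $\nabla^2 f(\mathrm{prox}_{\lambda\varphi}(z_{k+1}))$; no accuracy is required unless stated). *)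

(* Defs.v *)
From HB Require Import structures.
From mathcomp Require Import all_boot all_order all_algebra.
From mathcomp Require Import all_classical all_reals all_analysis.

Set Implicit Arguments.
Unset Strict Implicit.
Unset Printing Implicit Defensive.

Import Order.TTheory GRing.Theory Num.Theory.
Import numFieldNormedType.Exports.

Local Open Scope classical_set_scope.
Local Open Scope ring_scope.

Section EuclideanSpace.
Context {R : realType} {n : nat}.
Implicit Types u v x : 'cV[R]_n.

(* The library norm on matrices is the sup norm; it is used below only through
   the topology it induces (limits, semicontinuity, differentiability). *)
Definition dotp u v : R := \sum_(i < n) u i ord0 * v i ord0.

Definition enorm v : R := Num.sqrt (dotp v v).

Definition grad (f : 'cV[R]_n -> R^o) x : 'cV[R]_n :=
  \col_(i < n) 'D_(delta_mx i ord0) f x.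

Definition continuously_differentiable (f : 'cV[R]_n -> R^o) : Prop :=
  (forall x, differentiable f x) /\ continuous (grad f).

Definition elipschitz (L : R) (A : set 'cV[R]_n) (G : 'cV[R]_n -> 'cV[R]_n) :
    Prop :=
  forall x y, A x -> A y -> enorm (G x - G y) <= L * enorm (x - y).

End EuclideanSpace.

Section ConvexAnalysis.
Context {R : realType} {n : nat}.
Implicit Types (phi : 'cV[R]_n -> \bar R) (x y v z : 'cV[R]_n).

Definition effective_domain phi : set 'cV[R]_n := [set x | (phi x < +oo)%E].

Definition proper_function phi : Prop :=
  (forall x, (-oo < phi x)%E) /\ effective_domain phi !=set0.

(* Meaningful for functions that avoid -oo; the library convention 0 * +oo = 0
   makes the cases t = 0 and t = 1 trivial. *)
Definition econvex_function phi : Prop :=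
  forall x y (t : R), 0 <= t <= 1 ->
    (phi (t *: x + (1 - t) *: y)%R <= t%:E * phi x + (1 - t)%:E * phi y)%E.

Definition subdifferential phi x : set 'cV[R]_n :=
  [set v | forall y, (phi x + (dotp v (y - x))%:E <= phi y)%E].

Definition dom_subdifferential phi : set 'cV[R]_n :=
  [set x | subdifferential phi x !=set0].

(* The default value 0 is never taken when phi is convex, lower semicontinuous
   and proper: the set of minimisers is then a singleton. *)
Definition prox phi (lambda : R) z : 'cV[R]_n :=
  xget 0 [set y | forall y',
    (phi y + ((2 * lambda)^-1 * enorm (z - y) ^+ 2)%:E <=
     phi y' + ((2 * lambda)^-1 * enorm (z - y') ^+ 2)%:E)%E].

End ConvexAnalysis.

Section ClarkeJacobian.
Context {R : realType} {n : nat}.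
Implicit Types (F : 'cV[R]_n -> 'cV[R]_n) (x y : 'cV[R]_n).

(* Column-vector convention: 'd F y h = jacobian_mx F y *m h. *)
Definition jacobian_mx F y : 'M[R]_n :=
  \matrix_(i < n, j < n) ('d F y (delta_mx j ord0) : 'cV[R]_n) i ord0.

Definition bouligand_jacobian F x : set 'M[R]_n :=
  [set J | exists y : nat -> 'cV[R]_n,
     [/\ forall i, differentiable F (y i),
         y i @[i --> \oo] --> x
       & jacobian_mx F (y i) @[i --> \oo] --> J]].

Definition convex_hull (A : set 'M[R]_n) : set 'M[R]_n :=
  [set J | exists (m : nat) (w : 'I_m -> R) (a : 'I_m -> 'M[R]_n),
     [/\ forall i, 0 <= w i /\ A (a i),
         \sum_(i < m) w i = 1
       & J = \sum_(i < m) w i *: a i]].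

Definition clarke_jacobian F x : set 'M[R]_n :=
  convex_hull (bouligand_jacobian F x).

End ClarkeJacobian.

Section ConjugateGradient.
Context {R : realType} {n : nat}.

(* Passes i, i+1, ... of the CG loop, [fuel] of them remaining.  In exact
   arithmetic r_n = 0 when no other exit is taken, so for symmetric S the exit
   fuel = 0 is not reached from [cg]. *)
Fixpoint cg_loop (S : 'M[R]_n) (eps : R) (fuel i : nat) (q r p : 'cV[R]_n) :
    'cV[R]_n :=
  if fuel is fuel'.+1 then
    if dotp p (S *m p) <= 0 then (if i == 0%N then p else q)
    else
      let alpha := enorm r ^+ 2 / dotp p (S *m p) in
      let q' := q + alpha *: p in
      let r' := r + alpha *: (S *m p) in
      if enorm r' <= eps then q'
      else
        let beta := enorm r' ^+ 2 / enorm r ^+ 2 in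
        cg_loop S eps fuel' i.+1 q' r' (- r' + beta *: p)
  else q.

Definition cg (S : 'M[R]_n) (g : 'cV[R]_n) (eps : R) : 'cV[R]_n :=
  if enorm g <= eps then 0 else cg_loop S eps n 0 0 g (- g).

End ConjugateGradient.

Record alg_params (R : realType) (n : nat) := AlgParams {
  z_init : 'cV[R]_n;
  B_init : 'M[R]_n;
  Lbar : R;
  tau_init : R;
  sigma : R;
  rho : R;
  gamma : R;
  nu_max : R;
  qexp : R;
  eta_max : R;
  eps : nat -> R;
  nu : nat -> R
}.

Definition admissible (R : realType) (n : nat) (P : alg_params R n) : Prop :=
  [/\ (B_init P)^T = B_init P,
      0 < Lbar P /\ 0 < tau_init P,
      [/\ 0 < sigma P < 1, 0 < rho P < 1, 0 < gamma P < 1 & 0 < nu_max P < 1],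
      0 < qexp P /\ 0 < eta_max P
    & forall k, 0 <= eps P k /\ 0 < nu P k <= nu_max P].

Section Algorithm.
Context {R : realType} {n : nat}.
Variables (f : 'cV[R]_n -> R^o) (phi : 'cV[R]_n -> \bar R) (lambda : R).
Variable P : alg_params R n.

Local Notation pr := (prox phi lambda).

Definition objective (x : 'cV[R]_n) : \bar R := ((f x)%:E + phi x)%E.

Definition normal_map (z : 'cV[R]_n) : 'cV[R]_n :=
  grad f (pr z) + lambda^-1 *: (z - pr z).

Definition chi (z : 'cV[R]_n) : R := enorm (normal_map z).

Definition merit (tau : R) (z : 'cV[R]_n) : \bar R :=
  (objective (pr z) + (tau * lambda / 2 * chi z ^+ 2)%:E)%E.

Definition M_mx (B D : 'M[R]_n) : 'M[R]_n :=
  B *m D + lambda^-1 *: (1%:M - D).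

Definition e_dir (k : nat) (z : 'cV[R]_n) (B D : 'M[R]_n) : 'cV[R]_n :=
  let M := M_mx B D in
  let q := cg (D *m M) (D *m normal_map z) (eps P k) in
  lambda^-1 *: q - M *m q.

Definition b_coef (k : nat) : R :=
  (k%:R * ln (k%:R + 1) ^+ 2) `^ qexp P.

Definition eta_coef (k : nat) (z : 'cV[R]_n) : R :=
  Num.min (b_coef k * chi z `^ qexp P) (eta_max P).

Definition step (k : nat) (z : 'cV[R]_n) (B D : 'M[R]_n) (alpha : R) :
    'cV[R]_n :=
  let d := - normal_map z in
  let e := e_dir k z B D in
  if eta_coef k z * enorm e <= chi z
  then (alpha * lambda) *: (d + alpha *: e)
  else (alpha * lambda) *: d.

Definition L_trial (z s : 'cV[R]_n) : R :=
  let x := pr z in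
  let p := pr (z + s) in
  let U := f p - f x - dotp (grad f x) (p - x) in
  let V := enorm (p - x) in
  let W := enorm (grad f p - grad f x) in
  if V != 0 then Num.max (2 * U / V ^+ 2) (W / V) else Lbar P.

Definition tau_trial (k : nat) (tau_prev : R) (z s : 'cV[R]_n) : R :=
  Num.min
    (2 * gamma P * (1 - nu P k) / (L_trial z s ^+ 2 * lambda ^+ 2 + 2))
    tau_prev.

Definition ls_test (k : nat) (tau_prev : R) (z : 'cV[R]_n) (B D : 'M[R]_n)
    (t : nat) : Prop :=
  let alpha := rho P ^+ t in
  let s := step k z B D alpha in
  let tau := tau_trial k tau_prev z s in
  (merit tau (z + s)%R - merit tau z <=
   (- (sigma P * lambda * tau * alpha / 2) * chi z ^+ 2
    - nu P k / (lambda * alpha) * enorm (pr (z + s) - pr z) ^+ 2)%:E)%E.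

Definition ls_stops_at (k : nat) (tau_prev : R) (z : 'cV[R]_n)
    (B D : 'M[R]_n) (t : nat) : Prop :=
  ls_test k tau_prev z B D t /\
  forall t', (t' < t)%N -> ~ ls_test k tau_prev z B D t'.

(* [tau k] stands for tau_{k-1}, so that [tau 0] is tau_{-1}.
   The clauses at index k constrain the sequences only while the algorithm has
   not terminated.  A run is not assumed to have terminating linesearches: the
   update to index k+1 is imposed for the t at which linesearch k stops, and
   if there were no such t, then z_{k+1} and tau_k would be unconstrained. *)
Definition generated (z : nat -> 'cV[R]_n) (B D : nat -> 'M[R]_n)
    (tau : nat -> R) : Prop :=
  [/\ z 0%N = z_init P, B 0%N = B_init P, tau 0%N = tau_init P
    & forall k, (forall j, (j <= k)%N -> normal_map (z j) != 0) ->
      [/\ clarke_jacobian pr (z k) (D k),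
          (B k.+1)^T = B k.+1
        & forall t, ls_stops_at k (tau k) (z k) (B k) (D k) t ->
            let s := step k (z k) (B k) (D k) (rho P ^+ t) in
            z k.+1 = z k + s /\ tau k.+1 = tau_trial k (tau k) (z k) s]].

Definition terminates_at (z : nat -> 'cV[R]_n) (k : nat) : Prop :=
  normal_map (z k) = 0 /\ forall j, (j < k)%N -> normal_map (z j) != 0.

End Algorithm.

(* Main.v *)
Require Import Defs.
From HB Require Import structures.
From mathcomp Require Import all_boot all_order all_algebra.
From mathcomp Require Import all_classical all_reals all_analysis.
From mathcomp Require Import ring lra.

Set Implicit Arguments.
Unset Strict Implicit.
Unset Printing Implicit Defensive.

Import Order.TTheory GRing.Theory Num.Theory.
Import numFieldNormedType.Exports.

Local Open Scope classical_set_scope.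
Local Open Scope ring_scope.

(** The argument is a descent argument for the merit function along the run.
    A step perturbs a multiple of - F, where F is the normal map at z_k, by the
    correction e_k, and the second-order test keeps this perturbation under
    control: eta_k |e_k| <= chi (z_k).

    The proximal map is well defined ([prox_minimizer_exists]); its optimality
    condition makes (z - prox z) / lambda a subgradient at prox z
    ([prox_subgradient]), and hence the map is firmly nonexpansive
    ([prox_firm]).  For a trial step s with proximal displacement v, the
    subgradient inequality at the new point bounds the change of the objective
    by an expression whose leading term is the inner product of F with v; the same
    inner product appears in the change of |F|^2 with the weight - tau.  By firm nonexpansiveness that inner product is at most
    - |v|^2 / (lambda alpha) up to a term in e.  The choice of tau balances the
    variation of the gradient against this gain, so that for small alpha the
    merit function drops by more than the linesearch asks for
    ([sufficient_decrease]).  Since all proximal points lie in the domain of phi,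
    the trial Lipschitz estimates are bounded ([L_trial_spec]), so tau stays
    above a positive constant and smallness of alpha means alpha <= c0 and
    alpha |e| <= c1 chi with constants independent of the iterate
    ([ls_test_small_step]).  Consequently every linesearch stops, with a step
    size at least a constant multiple of min (1, eta_k) ([linesearch_stops]).

    Merit values along the run decrease and are bounded below because psi is.
    Summing the decrements gives the summability of nu_k |x_{k+1} - x_k|^2 and
    alpha_k chi (z_k)^2 -> 0 ([decrease_summable]).  As b_k >= b_1 > 0 for k >= 1,
    the lower bound on alpha_k is bounded away from zero wherever chi (z_k) is,
    so chi (z_k) -> 0 ([cvg0_of_min_weight]). *)

(** * The Euclidean inner product and norm *)

Section Euclid.
Context {R : realType} {n : nat}.
Implicit Types (u v w : 'cV[R]_n) (a : R).

Lemma dotpC u v : dotp u v = dotp v u.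
Proof. by apply: eq_bigr => i _; rewrite mulrC. Qed.

Lemma dotpDl u v w : dotp (u + v) w = dotp u w + dotp v w.
Proof.
by rewrite /dotp -big_split; apply: eq_bigr => i _; rewrite mxE mulrDl.
Qed.

Lemma dotpZl a u v : dotp (a *: u) v = a * dotp u v.
Proof.
by rewrite /dotp mulr_sumr; apply: eq_bigr => i _; rewrite mxE mulrA.
Qed.

Lemma dotpNl u v : dotp (- u) v = - dotp u v.
Proof. by rewrite -scaleN1r dotpZl mulN1r. Qed.

Lemma dotpDr u v w : dotp w (u + v) = dotp w u + dotp w v.
Proof. by rewrite dotpC dotpDl !(dotpC w). Qed.

Lemma dotpZr a u v : dotp u (a *: v) = a * dotp u v.
Proof. by rewrite dotpC dotpZl dotpC. Qed.

Lemma dotpNr u v : dotp u (- v) = - dotp u v.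
Proof. by rewrite dotpC dotpNl dotpC. Qed.

Lemma dotp0r u : dotp u 0 = 0.
Proof. by rewrite -(scale0r (0 : 'cV[R]_n)) dotpZr mul0r. Qed.

Definition dotpE := (dotpDl, dotpDr, dotpNl, dotpNr, dotpZl, dotpZr).

Lemma dotp_ge0 v : 0 <= dotp v v.
Proof. by apply: sumr_ge0 => i _; rewrite -expr2 sqr_ge0. Qed.

Lemma sqr_enorm v : enorm v ^+ 2 = dotp v v.
Proof. by rewrite sqr_sqrtr // dotp_ge0. Qed.

Lemma enorm_ge0 v : 0 <= enorm v.
Proof. exact: sqrtr_ge0. Qed.

Lemma enorm0 : enorm (0 : 'cV[R]_n) = 0.
Proof. by rewrite /enorm dotp0r sqrtr0. Qed.

Lemma enormZ a v : enorm (a *: v) = `|a| * enorm v.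
Proof.
by rewrite /enorm dotpZl dotpZr mulrA -expr2 sqrtrM ?sqr_ge0// sqrtr_sqr.
Qed.

Lemma coord_le_enorm v i : `|v i ord0| <= enorm v.
Proof.
rewrite -sqrtr_sqr ler_sqrt ?dotp_ge0// /dotp (bigD1 i)//= -expr2 lerDl.
by apply: sumr_ge0 => j _; rewrite -expr2 sqr_ge0.
Qed.

(** Half of the equivalence between the Euclidean norm and the sup norm that
    carries the topology: Euclidean Cauchy sequences converge. *)
Lemma norm_le_enorm v : `|v| <= enorm v.
Proof.
rewrite /Num.norm/= mx_normrE; apply: bigmax_le => [|[i j] _].
  exact: enorm_ge0.
by rewrite (ord1 j) coord_le_enorm.
Qed.

Lemma enorm_eq0 v : (enorm v == 0) = (v == 0).
Proof.
apply/idP/eqP => [/eqP v0|->]; last by rewrite enorm0.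
by apply/eqP; rewrite -normr_le0 -v0 norm_le_enorm.
Qed.

(** Up to the factor [dotp v v], the gap in the squared inequality is the
    squared length of [dotp v v *: u - dotp u v *: v], the component of [u]
    orthogonal to [v]. *)
Lemma cauchy_schwarz u v : `|dotp u v| <= enorm u * enorm v.
Proof.
have [/eqP|v0] := eqVneq (enorm v) 0.
  rewrite enorm_eq0 => /eqP ->.
  by rewrite enorm0 mulr0 dotp0r normr0.
have vv0 : 0 < dotp v v.
  by rewrite -sqr_enorm exprn_gt0// lt_neqAle eq_sym v0 enorm_ge0.
rewrite -sqrtr_sqr /enorm -sqrtrM ?dotp_ge0// ler_sqrt ?mulr_ge0 ?dotp_ge0//.
have := dotp_ge0 (dotp v v *: u - dotp u v *: v).
rewrite !dotpE (dotpC v u).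
set A := dotp u u; set B := dotp u v; set C := dotp v v in vv0 *.
move=> h; have {h} : 0 <= C * (A * C - B ^+ 2) by lra.
by rewrite pmulr_rge0// subr_ge0.
Qed.

Lemma dotp_le u v : dotp u v <= enorm u * enorm v.
Proof. exact: le_trans (ler_norm _) (cauchy_schwarz u v). Qed.

Lemma sqr_enormD_le3 u v w :
  enorm (u + v + w) ^+ 2 <= 3 * (enorm u ^+ 2 + enorm v ^+ 2 + enorm w ^+ 2).
Proof.
rewrite !sqr_enorm.
have := dotp_ge0 (u - v); have := dotp_ge0 (u - w); have := dotp_ge0 (v - w).
rewrite !dotpE (dotpC v u) (dotpC w u) (dotpC w v); lra.
Qed.

Lemma dotp_continuous : continuous (fun v => dotp v v).
Proof.
rewrite /dotp; apply: continuous_big => [|i _ v]; first exact: add_continuous.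
by apply: (@cvgM _ _ (nbhs (v : 'cV[R]_n)));
  exact: (@coord_continuous R n 1 i ord0 v).
Qed.

End Euclid.

(** * The proximal map of a convex function *)

Lemma ler_addgt0 (R : realType) (a b : R) :
  (forall e : R, 0 < e -> a <= b + e) -> a <= b.
Proof. by move=> h; apply/ler_addgt0Pr. Qed.

(** Meaningful only on the effective domain: [fine] sends +oo to 0. *)
Definition real_value (R : realType) (n : nat) (phi : 'cV[R]_n -> \bar R) x : R :=
  fine (phi x).

Section ProximalMap.
Context {R : realType} {n : nat}.
Variable phi : 'cV[R]_n -> \bar R.
Hypothesis phi_convex : econvex_function phi.
Hypothesis phi_lsc : lower_semicontinuous phi.
Hypothesis phi_proper : proper_function phi.
Implicit Types x y z : 'cV[R]_n.

Local Notation dom := (effective_domain phi).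
Local Notation g := (real_value phi).

Lemma domE x : dom x -> phi x = (g x)%:E.
Proof.
move=> dx; rewrite /real_value fineK// fin_numElt; apply/andP; split => //.
exact: phi_proper.1.
Qed.

Lemma convex_fine (t : R) x y : 0 <= t <= 1 -> dom x -> dom y ->
  dom (t *: x + (1 - t) *: y) /\
  g (t *: x + (1 - t) *: y) <= t * g x + (1 - t) * g y.
Proof.
move=> t01 dx dy; have := phi_convex x y t01.
rewrite (domE dx) (domE dy) -!EFinM -EFinD => h.
have dw : dom (t *: x + (1 - t) *: y) by exact: le_lt_trans h (ltry _).
by split => //; move: h; rewrite (domE dw) lee_fin.
Qed.

(** Lower semicontinuity bounds [phi] from below near one point of its domain;
    along each ray from that point convexity turns this into a linear bound. *)
Lemma convex_linear_minorant : exists x0 (a b : R),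
  forall y, dom y -> a - b * enorm (y - x0) <= g y.
Proof.
have [x0 dx0] := phi_proper.2.
have [V nV hV] : exists2 V : set 'cV[R]_n, nbhs x0 V &
    forall y, V y -> ((g x0 - 1)%:E < phi y)%E.
  by apply: phi_lsc; rewrite (domE dx0) lte_fin; lra.
have [d /= d0 dV] := (nbhs_ballP _ _).1 nV.
exists x0, (g x0 - 1), (2 / d) => y dy.
have near_ge w : dom w -> `|w - x0| < d -> g x0 - 1 < g w.
  move=> dw wx; have : V w by apply: dV; rewrite -ball_normE /= distrC.
  by move/hV; rewrite (domE dw) lte_fin.
set r := enorm (y - x0); have r0 : 0 <= r := enorm_ge0 _.
have [rd|dr] := ltP r d.
  have := near_ge y dy (le_lt_trans (norm_le_enorm _) rd).
  have : 0 <= 2 / d * r by rewrite mulr_ge0 ?divr_ge0 // ltW.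
  lra.
have r_gt0 : 0 < r by exact: lt_le_trans d0 dr.
(* The weight t puts the convex combination w below at distance d / 2 of x0. *)
set t := d / (2 * r).
have t_gt0 : 0 < t by rewrite divr_gt0 ?mulr_gt0.
have tr : t * r = d / 2 by rewrite /t; field; rewrite gt_eqF.
have t_le1 : t <= 1 by rewrite ler_pdivrMr ?mulr_gt0//; lra.
have t01 : 0 <= t <= 1 by rewrite t_le1 ltW.
have [dw gw] := convex_fine t01 dy dx0.
have wx : `|t *: y + (1 - t) *: x0 - x0| < d.
  have -> : t *: y + (1 - t) *: x0 - x0 = t *: (y - x0).
    by rewrite scalerBl scale1r scalerBr -addrA (addrAC x0) subrr add0r.
  apply: le_lt_trans (norm_le_enorm _) _.
  rewrite enormZ gtr0_norm// tr; lra.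
have gx := near_ge _ dw wx.
have : 0 <= t * (g y - (g x0 - 1 - 2 / d * r)).
  have : t * (2 / d * r) = 1 by rewrite mulrCA tr; field; rewrite gt_eqF.
  lra.
by rewrite pmulr_rge0// subr_ge0.
Qed.

(** The quadratic term of the proximal problem beats the linear minorant. *)
Lemma prox_objective_minorant (c : R) z : 0 < c ->
  exists m : R, forall y, dom y -> m <= g y + c * enorm (z - y) ^+ 2.
Proof.
move=> c0; have [x0 [a [b hb]]] := convex_linear_minorant.
exists (a - b ^+ 2 / (2 * c) - c * enorm (z - x0) ^+ 2) => y dy.
have := hb y dy; set r := enorm (y - x0) => gy.
have h1 : r ^+ 2 <= 2 * enorm (z - y) ^+ 2 + 2 * enorm (z - x0) ^+ 2.
  rewrite !sqr_enorm.
  have -> : y - x0 = (z - x0) - (z - y) by rewrite opprB [RHS]addrC addrA subrK.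
  move: (z - x0) (z - y) => u v.
  have := dotp_ge0 (u + v); rewrite !dotpE (dotpC v u); lra.
have h2 : b * r <= c * r ^+ 2 / 2 + b ^+ 2 / (2 * c).
  have : 0 <= (c * r - b) ^+ 2 / (2 * c).
    by rewrite divr_ge0 ?sqr_ge0// mulr_ge0// ltW.
  have -> : (c * r - b) ^+ 2 / (2 * c) = c * r ^+ 2 / 2 - b * r + b ^+ 2 / (2 * c).
    by field; rewrite gt_eqF.
  lra.
nra.
Qed.

(** By the parallelogram identity the objective of the proximal problem is
    strongly convex, so a minimizing sequence is Cauchy; lower semicontinuity
    makes its limit a minimizer. *)
Lemma prox_minimizer_exists (c : R) z : 0 < c ->
  exists2 x, dom x & forall y, dom y ->
    g x + c * enorm (z - x) ^+ 2 <= g y + c * enorm (z - y) ^+ 2.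
Proof.
move=> c0; pose Q y : R := g y + c * enorm (z - y) ^+ 2.
have [m hm] := prox_objective_minorant z c0.
pose E : set R := Q @` dom; have [x0 dx0] := phi_proper.2.
have E0 : E !=set0 by exists (Q x0), x0.
have lbE : has_lbound E by exists m => _ [y dy <-]; exact: hm.
have infE : has_inf E by split.
set I : R := inf E; have ge_I y : dom y -> I <= Q y.
  by move=> dy; apply: ge_inf => //; exists y.
have /choice[y hy] (k : nat) : exists y, dom y /\ Q y < I + k.+1%:R^-1.
  have k0 : 0 < k.+1%:R^-1 :> R by rewrite invr_gt0.
  by have [_ [y dy <-] yI] := inf_adherent k0 infE; exists y.
(* Parallelogram identity at the midpoint of two almost minimizers. *)
have gap u v (s : R) : dom u -> dom v -> Q u < I + s -> Q v < I + s ->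
    c * enorm (u - v) ^+ 2 <= 4 * s.
  move=> du dv us vs.
  have h01 : 0 <= (2^-1 : R) <= 1 by lra.
  have [dw gw] := convex_fine h01 du dv.
  have := ge_I _ dw; move: us vs gw; rewrite /Q !sqr_enorm.
  have -> : (1 - 2^-1 : R) = 2^-1 by lra.
  have -> : z - (2^-1 *: u + 2^-1 *: v) = 2^-1 *: ((z - u) + (z - v)).
    rewrite addrACA -opprD -scalerDr scalerBr; congr (_ - _).
    by rewrite -[in RHS](scale1r z) -scalerDl scalerA mulVf ?scale1r.
  have -> : u - v = (z - v) - (z - u).
    by rewrite opprB [RHS]addrC addrA subrK.
  move: (z - u) (z - v) => a b; rewrite !dotpE (dotpC b a).
  nra.
have y_cauchy : cauchy (y k @[k --> \oo]).
  apply: cauchy_exP => e e0.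
  have s0 : 0 < c * e ^+ 2 / 4 by rewrite divr_gt0 ?mulr_gt0 ?exprn_gt0.
  have [N _ hN] := near_infty_natSinv_lt (PosNum s0).
  exists (y N), N => // k /= Nk; rewrite -ball_normE /=.
  apply: le_lt_trans (norm_le_enorm _) _.
  rewrite -(ltr_pXn2r (n := 2)) ?nnegrE ?enorm_ge0 ?ltW//.
  have [dN QN] := hy N; have [dk Qk] := hy k.
  have kN : k.+1%:R^-1 <= N.+1%:R^-1 :> R by rewrite lef_pV2 ?posrE// ler_nat.
  have := gap _ _ _ dN dk QN (lt_le_trans Qk _).
  rewrite lerD2l => /(_ kN) h.
  have /= hN1 := hN N (leqnn N).
  rewrite -(ltr_pM2l c0); apply: le_lt_trans h _.
  by rewrite mulrC -ltr_pdivlMr.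
have [x y_cvg] : exists x : 'cV[R]_n, y k @[k --> \oo] --> x.
  by exists (lim (y k @[k --> \oo])); apply/cauchy_cvgP.
have sq_cvg : enorm (z - y k) ^+ 2 @[k --> \oo] --> enorm (z - x) ^+ 2.
  under eq_fun do rewrite sqr_enorm.
  rewrite sqr_enorm.
  apply: (@cvg_comp _ _ _ (fun k => z - y k) (fun v => dotp v v) \oo
            (nbhs (z - x))); last exact: dotp_continuous.
  by apply: cvgB => //; exact: cvg_cst.
(* Any real a below phi x, which may still be +oo, yields an upper bound. *)
have phix_le (a : R) : (a%:E < phi x)%E -> a + c * enorm (z - x) ^+ 2 <= I.
  move=> /phi_lsc[V nV hV]; apply: ler_addgt0 => e e0.
  have e30 : 0 < e / 3 by rewrite divr_gt0.
  have [N1 _ hN1] := y_cvg V nV.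
  have e3c : 0 < e / 3 / c by rewrite divr_gt0.
  have [N2 _ hN2] := (cvgrPdist_lt _ _).1 sq_cvg _ e3c.
  have [N3 _ hN3] := near_infty_natSinv_lt (PosNum e30).
  pose k := maxn N1 (maxn N2 N3).
  have [dk Qk] := hy k.
  have ak : a < g (y k).
    by rewrite -lte_fin -(domE dk); apply: hV; exact: hN1 k (leq_maxl _ _).
  have /= := hN2 k (leq_trans (leq_maxl _ _) (leq_maxr _ _)).
  rewrite ltr_pdivlMr// => d2.
  have d3 : k.+1%:R^-1 < e / 3 :> R.
    exact: hN3 k (leq_trans (leq_maxr _ _) (leq_maxr _ _)).
  move: Qk; rewrite /Q => Qk.
  have d1 : c * (enorm (z - x) ^+ 2 - enorm (z - y k) ^+ 2) < e / 3.
    by rewrite mulrC; apply: le_lt_trans d2; rewrite ler_pM2r// ler_norm.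
  move: (k.+1%:R^-1 : R) Qk d3 => q Qk d3; lra.
have dx : dom x.
  rewrite /effective_domain /= ltNge leye_eq; apply/negP => /eqP phix.
  have := phix_le (I - c * enorm (z - x) ^+ 2 + 1); rewrite phix ltry => /(_ isT).
  lra.
exists x => // u du; apply: le_trans (ge_I u du).
apply: ler_addgt0 => e e0.
have := phix_le (g x - e); rewrite (domE dx) lte_fin => /(_ _).
by rewrite ltrBlDr ltrDl => /(_ e0); lra.
Qed.

Variable lambda : R.
Hypothesis lambda_gt0 : 0 < lambda.

Local Notation pr := (prox phi lambda).

Lemma prox_minimizes z : dom (pr z) /\ forall y, dom y ->
  g (pr z) + (2 * lambda)^-1 * enorm (z - pr z) ^+ 2 <=
  g y + (2 * lambda)^-1 * enorm (z - y) ^+ 2.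
Proof.
have c0 : 0 < (2 * lambda)^-1 by rewrite invr_gt0 mulr_gt0.
have [x dx hx] := prox_minimizer_exists z c0.
have argmin y' : (phi (pr z) + ((2 * lambda)^-1 * enorm (z - pr z) ^+ 2)%:E <=
    phi y' + ((2 * lambda)^-1 * enorm (z - y') ^+ 2)%:E)%E.
  rewrite /prox; case: xgetP => [y _ /(_ y')//|/(_ x)/= []].
  move=> y; have [dy|] := boolP (phi y < +oo)%E.
    by rewrite (domE dx) (domE dy) -!EFinD lee_fin hx.
  by rewrite -leNgt leye_eq => /eqP ->; rewrite addye// leey.
have dpr : dom (pr z).
  have := argmin x; rewrite (domE dx) -EFinD => h.
  rewrite /effective_domain /= ltNge leye_eq; apply/negP => /eqP phix.
  by move: h; rewrite phix addye// leye_eq.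
split => // y dy; have := argmin y.
by rewrite (domE dpr) (domE dy) -!EFinD lee_fin.
Qed.

Lemma dom_prox z : dom (pr z).
Proof. exact: (prox_minimizes z).1. Qed.

(** First-order optimality of the proximal problem, obtained by comparing
    [prox phi lambda z] with points of the segment joining it to [y]. *)
Lemma prox_subgradient_fine z y : dom y ->
  g (pr z) + dotp (lambda^-1 *: (z - pr z)) (y - pr z) <= g y.
Proof.
move=> dy; have [dx hx] := prox_minimizes z.
set x := pr z in dx hx *.
have [u uE] : {u | u = z - x} by exists (z - x).
have [h hE] : {h | h = y - x} by exists (y - x).
pose c := (2 * lambda)^-1; have c0 : 0 < c by rewrite invr_gt0 mulr_gt0.
have cE : lambda^-1 = 2 * c by rewrite /c; field; rewrite gt_eqF.
rewrite dotpZl cE -uE -hE.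
have key (t : R) : 0 < t -> t <= 1 ->
    g x + 2 * c * dotp u h <= g y + t * (c * dotp h h).
  move=> t0 t1; have t01 : 0 <= t <= 1 by rewrite ltW.
  have [dw gw] := convex_fine t01 dy dx.
  have := hx _ dw; rewrite !sqr_enorm -/c -uE.
  have -> : z - (t *: y + (1 - t) *: x) = u - t *: h.
    by apply/matrixP => i j; rewrite uE hE !mxE; ring.
  rewrite !dotpE (dotpC h u).
  have : 0 <= t * (g y + t * (c * dotp h h) - (g x + 2 * c * dotp u h)) ->
      g x + 2 * c * dotp u h <= g y + t * (c * dotp h h).
    by rewrite pmulr_rge0// subr_ge0.
  move=> + H; apply; lra.
apply: ler_addgt0 => e e0.
pose q := c * dotp h h; have q0 : 0 <= q by rewrite mulr_ge0 ?dotp_ge0 ?ltW.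
(* With t = e / (q + e) the remainder t * q stays below e, even when q = 0. *)
have et : 0 < e / (q + e) by rewrite divr_gt0//; lra.
have et1 : e / (q + e) <= 1 by rewrite ler_pdivrMr; lra.
apply: le_trans (key _ et et1) _; rewrite lerD2l -/q.
rewrite mulrAC ler_pdivrMr; last lra.
by rewrite ler_pM2l//; lra.
Qed.

Lemma prox_subgradient z :
  subdifferential phi (pr z) (lambda^-1 *: (z - pr z)).
Proof.
move=> y; have [dy|] := boolP (phi y < +oo)%E.
  by rewrite (domE (dom_prox z)) (domE dy) -EFinD lee_fin prox_subgradient_fine.
by rewrite -leNgt leye_eq => /eqP ->; rewrite leey.
Qed.

(** Monotonicity of the subdifferential at [pr z] and [pr (z + s)], i.e. firm
    nonexpansiveness of the proximal map. *)
Lemma prox_firm z s :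
  enorm (pr (z + s) - pr z) ^+ 2 <= dotp s (pr (z + s) - pr z).
Proof.
have := prox_subgradient_fine z (dom_prox (z + s)).
have := prox_subgradient_fine (z + s) (dom_prox z).
set x := pr z; set p := pr (z + s); rewrite sqr_enorm => h1 h2.
have {h1 h2} : dotp (lambda^-1 *: (z + s - p)) (x - p) +
    dotp (lambda^-1 *: (z - x)) (p - x) <= 0 by lra.
have -> : x - p = - (p - x) by rewrite opprB.
have -> : z + s - p = (z - x) + s - (p - x).
  by apply/matrixP => i j; rewrite !mxE; ring.
move: (p - x) (z - x) => v u; rewrite !dotpE => h.
have : lambda^-1 * (dotp v v - dotp s v) <= 0 by lra.
by rewrite pmulr_rle0 ?invr_gt0// subr_le0.
Qed.

End ProximalMap.

(** * Gradients and the mean value theorem *)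

Section Gradient.
Context {R : realType} {n : nat}.
Variable f : 'cV[R]_n -> R^o.
Implicit Types x y v : 'cV[R]_n.

Lemma diff_grad x v : differentiable f x -> 'd f x v = dotp (grad f x) v.
Proof.
move=> df; rewrite [in LHS](matrix_sum_delta v) linear_sum /dotp.
apply: eq_bigr => i _; rewrite big_ord1 linearZ/= mxE deriveE//.
by rewrite mulrC.
Qed.

Lemma mean_value_grad x v : (forall y, differentiable f y) ->
  exists2 t : R, 0 <= t <= 1 &
    f (x + v) - f x = dotp (grad f (x + t *: v)) v.
Proof.
move=> df; pose h (t : R) : R := f (x + t *: v).
have dh (t : R) : is_derive t 1 h (dotp (grad f (x + t *: v)) v).
  (* Along the line the difference quotients are those of 'D_v f. *)
  have quotientE : (fun s : R => s^-1 *: ((h \o shift t) (s *: 1) - h t : R^o)) =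
      (fun s : R => s^-1 *: ((f \o shift (x + t *: v)) (s *: v) - f (x + t *: v))).
    apply/funext => s /=; rewrite /h; congr (_ *: (f _ - _)).
    by rewrite [s *: 1]mulr1 scalerDl addrCA.
  have dv : derivable f (x + t *: v) v by exact: diff_derivable.
  split; first by rewrite /derivable quotientE.
  by rewrite /derive quotientE -diff_grad// -deriveE.
have [|t t01] := @MVT_segment R h _ 0 1 ler01 (fun t _ => dh t).
  by apply: derivable_within_continuous => t _; case: (dh t).
rewrite subr0 mulr1 /h scale1r scale0r addr0 => e.
by exists t => //; rewrite in_itv /= in t01.
Qed.

End Gradient.

(** * Decrease of the merit function under a small step *)

Section SufficientDecrease.
Context {R : realType}.

(** The inner products and squared norms of the linesearch estimate are replaced
    by real parameters, so that only real arithmetic remains: [A], [E2], [U2]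
    stand for the squared norms of F, e, u; [FE], [FV], [EV], [FW] for inner
    products; and [X] for |v|^2 / (a l), the natural size of the available
    decrease.  The coefficient of [X] is at most -1 + tau (Lk^2 l^2 / 2 + 1)
    plus errors of size [kap / 4], and that of [A] is -tau l a / 2 plus errors
    controlled by [c1]. *)
Lemma decrease_bound_scalar (l tau a nu sg kap c1 Lk : R)
    (A FE FV EV FW E2 X U2 dpsi : R) :
  0 < l -> 0 < tau <= 1 -> 0 < a <= 1 -> 0 < kap -> 0 <= c1 <= 1 -> 0 <= A ->
  0 <= X ->
  tau * (Lk ^+ 2 * l ^+ 2 / 2 + 1) <= 1 - nu - kap ->
  a * (l * Lk / 2 + 3 / 2 * (Lk ^+ 2 * l ^+ 2 + 1)) <= kap / 4 ->
  c1 ^+ 2 / kap <= tau * (1 - sg) / 4 -> c1 <= (1 - sg) / 10 ->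
  dpsi <= (1 - a) * FV + a ^+ 2 * EV - a * X + Lk / 2 * (a * l * X) ->
  FV <= a * EV - X ->
  a * EV <= kap * X / 4 + l * a * (c1 ^+ 2 / kap) * A ->
  a * FE <= c1 * A ->
  FW <= a * A / 2 + Lk ^+ 2 * l * X / 2 ->
  l * U2 <= 3 * (a ^+ 4 * (l * E2) + Lk ^+ 2 * a * l ^+ 2 * X + a * X) ->
  a ^+ 2 * E2 <= c1 ^+ 2 * A ->
  dpsi + tau / 2 * (l * (((1 - a) ^+ 2 - 1) * A +
       2 * (1 - a) * (a ^+ 2 * FE + FW) + U2)
     - 2 * (1 - a) * FV) <=
  - (sg * l * tau * a / 2) * A - nu * X.
Proof.
move=> l0 /andP[t0 t1] /andP[a0 a1] k0 /andP[c10 c11] A0 X0.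
move=> hth ha hc1 hc2 hpsi hFV hEV hFE hFW hU hE.
have [l0' t0' a0' k0'] : [/\ 0 <= l, 0 <= tau, 0 <= a & 0 <= kap].
  by split; exact: ltW.
have a1' : 0 <= 1 - a by lra.
have t1' : 0 <= 1 - tau by lra.
(* The objective contributes (1 - a) FV and the squared normal map
   - tau (1 - a) FV: what is left keeps a nonnegative weight as tau <= 1. *)
have hFV' : (1 - tau) * (1 - a) * FV <= (1 - tau) * (1 - a) * (a * EV - X).
  by apply: ler_wpM2l => //; rewrite mulr_ge0.
(* a * mu collects the two occurrences of EV. *)
pose mu := a + (1 - tau) * (1 - a).
have mu0 : 0 <= mu by rewrite addr_ge0 ?mulr_ge0//.
have mu1 : mu <= 1 by rewrite /mu; nra.
pose Y := kap * X / 4 + l * a * (c1 ^+ 2 / kap) * A.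
have Y0 : 0 <= Y.
  have ck0 : 0 <= c1 ^+ 2 / kap by rewrite divr_ge0 ?sqr_ge0//.
  apply: addr_ge0; first by rewrite divr_ge0// mulr_ge0//.
  by rewrite mulr_ge0// mulr_ge0// mulr_ge0.
have hEV' : mu * (a * EV) <= Y.
  apply: le_trans (ler_wpM2l mu0 hEV) _.
  exact: ler_piMl.
have la0 : 0 <= l * a by rewrite mulr_ge0.
have hY2 : l * a * (c1 ^+ 2 / kap) * A <= l * a * (tau * (1 - sg) / 4) * A.
  by apply: ler_wpM2r => //; apply: ler_wpM2l.
have hFE' : tau * l * (1 - a) * a * (a * FE) <= tau * l * a * (c1 * A).
  apply: (@le_trans _ _ (tau * l * (1 - a) * a * (c1 * A))).
    by apply: ler_wpM2l => //; rewrite !mulr_ge0.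
  apply: ler_wpM2r; first by rewrite mulr_ge0.
  rewrite -!mulrA; apply: ler_wpM2l; first by [].
  apply: ler_wpM2l; first by [].
  by apply: ler_piMl => //; lra.
have hFW' : tau * l * (1 - a) * FW <=
    tau * l * (1 - a) * (a * A / 2 + Lk ^+ 2 * l * X / 2).
  by apply: ler_wpM2l => //; rewrite !mulr_ge0.
have hE' : a ^+ 4 * E2 <= a * (c1 * A).
  have -> : a ^+ 4 * E2 = a ^+ 2 * (a ^+ 2 * E2) by ring.
  apply: (@le_trans _ _ (a ^+ 2 * (c1 ^+ 2 * A))).
    by apply: ler_wpM2l => //; rewrite sqr_ge0.
  rewrite !mulrA; apply: ler_wpM2r => //.
  apply: ler_pM; rewrite ?sqr_ge0 ?expr2//; nra.
have hU' : tau / 2 * (l * U2) <= tau / 2 * (3 * (l * (a * (c1 * A)) +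
    Lk ^+ 2 * a * l ^+ 2 * X + a * X)).
  apply: ler_wpM2l; first by rewrite divr_ge0.
  apply: le_trans hU _; rewrite ler_pM2l// !lerD2r mulrCA ler_pM2l//.
have hc3 : tau * l * a * (c1 * A) <= tau * l * a * ((1 - sg) / 10 * A).
  apply: ler_wpM2l; first by rewrite !mulr_ge0.
  exact: ler_wpM2r.
have hX1 : tau * (Lk ^+ 2 * l ^+ 2 / 2 + 1) * ((1 - a) * X) <=
    (1 - nu - kap) * ((1 - a) * X) by apply: ler_wpM2r; rewrite ?mulr_ge0.
have hX2 : a * (l * Lk / 2 + 3 / 2 * (Lk ^+ 2 * l ^+ 2 + 1)) * X <= kap / 4 * X.
  exact: ler_wpM2r.
have hth0 : 0 <= 1 - nu - kap.
  apply: le_trans hth; rewrite mulr_ge0// addr_ge0//.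
  by apply: divr_ge0 => //; apply: mulr_ge0; exact: sqr_ge0.
have hX3 : (1 - nu - kap) * ((1 - a) * X) <= (1 - nu - kap) * X.
  by apply: ler_wpM2l => //; rewrite ler_piMl//; lra.
have hX4 : tau * (3 / 2 * (Lk ^+ 2 * a * l ^+ 2 * X + a * X)) <=
    3 / 2 * (Lk ^+ 2 * a * l ^+ 2 * X + a * X).
  apply: ler_piMl => //; apply: mulr_ge0; first lra.
  apply: addr_ge0; last exact: mulr_ge0.
  apply: mulr_ge0 => //; apply: mulr_ge0; last exact: sqr_ge0.
  by apply: mulr_ge0 => //; exact: sqr_ge0.
have hX5 : 0 <= kap * X by rewrite mulr_ge0.
rewrite /Y /mu in hEV'.
(* Linear in the products bounded above. *)
clear - hpsi hFV' hEV' hY2 hFE' hFW' hU' hc3 hX1 hX2 hX3 hX4 hX5.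
lra.
Qed.

End SufficientDecrease.

Section VectorDecrease.
Context {R : realType} {n : nat}.

(** One linesearch trial in abstract form: [F] is the normal map at z, [v] the
    move of the proximal point, [w] the change of the gradient, [dpsi] the
    change of the objective, and [F + w + l^-1 *: (s - v)] the normal map at
    z + s.  Firm nonexpansiveness turns the sign of [dotp F v] into a gain of
    order |v|^2 / (a l), which pays for all terms in [v] and [w]; the term
    - tau l a |F|^2 pays for those in [e] as soon as [a |e|] is small against
    [|F|]. *)
Lemma sufficient_decrease (l tau a nu sg kap c1 Lk dpsi : R)
    (F e v w : 'cV[R]_n) :
  let s := (a * l) *: (- F + a *: e) in
  0 < l -> 0 < tau <= 1 -> 0 < a <= 1 -> 0 < kap -> 0 <= c1 <= 1 ->
  tau * (Lk ^+ 2 * l ^+ 2 / 2 + 1) <= 1 - nu - kap ->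
  a * (l * Lk / 2 + 3 / 2 * (Lk ^+ 2 * l ^+ 2 + 1)) <= kap / 4 ->
  c1 ^+ 2 / kap <= tau * (1 - sg) / 4 -> c1 <= (1 - sg) / 10 ->
  a * enorm e <= c1 * enorm F ->
  enorm w <= Lk * enorm v ->
  enorm v ^+ 2 <= dotp s v ->
  dpsi <= dotp F v + l^-1 * dotp (s - v) v + Lk / 2 * enorm v ^+ 2 ->
  dpsi + tau * l / 2 *
    (enorm (F + w + l^-1 *: (s - v)) ^+ 2 - enorm F ^+ 2) <=
  - (sg * l * tau * a / 2) * enorm F ^+ 2 - nu / (l * a) * enorm v ^+ 2.
Proof.
move=> s l0 t01 a01 k0 c01 hth ha hc1 hc2 heF hwv hfirm hpsi.
have /andP[a0 a1] := a01; have /andP[c10 c11] := c01.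
have ln0 : l != 0 by rewrite gt_eqF.
have an0 : a != 0 by rewrite gt_eqF.
pose X := enorm v ^+ 2 / (a * l).
have VX : enorm v ^+ 2 = a * l * X by rewrite /X mulrC divfK// mulf_neq0.
have X0 : 0 <= X by rewrite divr_ge0 ?sqr_ge0// mulr_ge0// ltW.
have dotp_sv : dotp s v = a * l * (- dotp F v + a * dotp e v).
  by rewrite /s !dotpE.
pose u := a ^+ 2 *: e + w - l^-1 *: v.
have FplusE : F + w + l^-1 *: (s - v) = (1 - a) *: F + u.
  apply/matrixP => i j; rewrite !mxE; field; exact: ln0.
have sqrFplus : enorm (F + w + l^-1 *: (s - v)) ^+ 2 =
    (1 - a) ^+ 2 * enorm F ^+ 2 + 2 * (1 - a) *
      (a ^+ 2 * dotp F e + dotp F w - l^-1 * dotp F v) + enorm u ^+ 2.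
  rewrite FplusE !sqr_enorm.
  have Fu : dotp F u = a ^+ 2 * dotp F e + dotp F w - l^-1 * dotp F v.
    by rewrite /u !dotpE.
  by rewrite -Fu; move: u {Fu FplusE} => u; rewrite !dotpE (dotpC u F); ring.
have N0 := enorm_ge0 F; have V0 := enorm_ge0 v; have E0 := enorm_ge0 e.
have W0 := enorm_ge0 w.
have NV : a * dotp e v <= c1 * enorm F * enorm v.
  apply: le_trans (ler_wpM2l (ltW a0) (dotp_le e v)) _.
  by rewrite mulrA ler_wpM2r.
have := @decrease_bound_scalar R l tau a nu sg kap c1 Lk (enorm F ^+ 2)
  (dotp F e) (dotp F v) (dotp e v) (dotp F w) (enorm e ^+ 2) X
  (enorm u ^+ 2) dpsi l0 t01 a01 k0 c01 (sqr_ge0 _) X0 hth ha hc1 hc2.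
have -> : nu / (l * a) * enorm v ^+ 2 = nu * X.
  by rewrite VX; field; rewrite an0 ln0.
have -> : tau * l / 2 * (enorm (F + w + l^-1 *: (s - v)) ^+ 2 - enorm F ^+ 2) =
  tau / 2 * (l * (((1 - a) ^+ 2 - 1) * enorm F ^+ 2 +
    2 * (1 - a) * (a ^+ 2 * dotp F e + dotp F w) + enorm u ^+ 2)
     - 2 * (1 - a) * dotp F v).
  by rewrite sqrFplus; field.
apply.
- apply: le_trans hpsi _; rewrite dotpDl dotpNl -sqr_enorm dotp_sv VX.
  rewrite le_eqVlt; apply/orP; left; apply/eqP; field; exact: ln0.
- move: hfirm; rewrite dotp_sv VX ler_pM2l ?mulr_gt0//; lra.
(* Young's inequality, as a completed square. *)
- apply: le_trans NV _.
  rewrite -subr_ge0.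
  have -> : kap * X / 4 + l * a * (c1 ^+ 2 / kap) * enorm F ^+ 2 -
      c1 * enorm F * enorm v =
      (kap * enorm v - 2 * a * l * c1 * enorm F) ^+ 2 / (4 * a * l * kap).
    by rewrite /X; field; rewrite an0 ln0 gt_eqF.
  by rewrite divr_ge0 ?sqr_ge0// !mulr_ge0// ltW.
- apply: le_trans (ler_wpM2l (ltW a0) (dotp_le F e)) _.
  by rewrite mulrCA expr2 [leRHS]mulrCA ler_wpM2l.
(* Young's inequality again, now balancing [a |F|^2] against [|w|^2 / a]. *)
- apply: le_trans (dotp_le F w) _.
  apply: le_trans (ler_wpM2l N0 hwv) _; rewrite -subr_ge0.
  have -> : a * enorm F ^+ 2 / 2 + Lk ^+ 2 * l * X / 2 -
      enorm F * (Lk * enorm v) =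
      (a * enorm F - Lk * enorm v) ^+ 2 / (2 * a).
    by rewrite /X; field; rewrite an0 ln0.
  by rewrite divr_ge0 ?sqr_ge0// mulr_ge0// ltW.
- have := sqr_enormD_le3 (a ^+ 2 *: e) w (- (l^-1 *: v)).
  rewrite -/u -scaleNr !enormZ !exprMn !real_normK ?num_real// sqrrN => hu.
  have hW : enorm w ^+ 2 <= Lk ^+ 2 * (a * l * X).
    by rewrite -VX -exprMn; apply: lerXn2r; rewrite ?nnegrE// (le_trans _ hwv).
  have := ler_wpM2l (ltW l0) hu; rewrite VX.
  have := ler_wpM2l (ltW l0) hW.
  have -> : l * (3 * (a ^+ 2 ^+ 2 * enorm e ^+ 2 + enorm w ^+ 2 +
    l^-1 ^+ 2 * (a * l * X))) = 3 * (a ^+ 4 * (l * enorm e ^+ 2) +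
    l * enorm w ^+ 2 + a * X) by field; exact: ln0.
  lra.
- rewrite -!exprMn; apply: lerXn2r => //; rewrite nnegrE mulr_ge0// ltW//.
Qed.

End VectorDecrease.

(** * The linesearch *)

Section Linesearch.
Context {R : realType} {n : nat}.
Variables (f : 'cV[R]_n -> R^o) (phi : 'cV[R]_n -> \bar R) (L lambda : R).
Variable P : alg_params R n.
Hypothesis f_C1 : continuously_differentiable f.
Hypothesis phi_convex : econvex_function phi.
Hypothesis phi_lsc : lower_semicontinuous phi.
Hypothesis phi_proper : proper_function phi.
Hypothesis grad_f_lip : elipschitz L (effective_domain phi) (grad f).
Hypothesis lambda_gt0 : 0 < lambda.
Hypothesis P_ok : admissible P.

Local Notation pr := (prox phi lambda).
Local Notation dom := (effective_domain phi).
Local Notation N := (normal_map f phi lambda).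
Local Notation chi := (chi f phi lambda).

Let dom_pr z : dom (pr z).
Proof. exact: dom_prox. Qed.

Lemma grad_lip_abs x y : dom x -> dom y ->
  enorm (grad f x - grad f y) <= `|L| * enorm (x - y).
Proof.
move=> dx dy; apply: le_trans (grad_f_lip dx dy) _.
by rewrite ler_wpM2r ?enorm_ge0 ?ler_norm.
Qed.

(** The mean value theorem loses a factor 2 against the sharp constant [L / 2],
    which is harmless: it only enters a bound on the trial Lipschitz
    estimates. *)
Lemma linearization_error_le x p : dom x -> dom p ->
  f p - f x - dotp (grad f x) (p - x) <= `|L| * enorm (p - x) ^+ 2.
Proof.
move=> dx dp; have [t t01] := mean_value_grad x (p - x) f_C1.1.
have -> : x + (p - x) = p by rewrite addrC subrK.
move=> ->; have /andP[t0 t1] := t01.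
have [dw _] := convex_fine phi_convex phi_proper t01 dp dx.
have wE : x + t *: (p - x) = t *: p + (1 - t) *: x.
  by apply/matrixP => i j; rewrite !mxE; ring.
rewrite -dotpNl -dotpDl wE; apply: le_trans (dotp_le _ _) _.
rewrite expr2 mulrA ler_wpM2r ?enorm_ge0//.
apply: le_trans (grad_lip_abs dw dx) _.
rewrite -wE addrC addKr enormZ (ger0_norm t0) ler_wpM2l//.
by rewrite ler_piMl ?enorm_ge0.
Qed.

Local Notation Lt := (L_trial f phi lambda P).

(** Proximal points lie in the domain of [phi], where the gradient of [f] is
    Lipschitz; in the degenerate case both points coincide and all differences
    vanish. *)
Lemma L_trial_spec z s (x := pr z) (p := pr (z + s)) :
  [/\ 0 <= Lt z s, Lt z s <= 2 * `|L| + Lbar P,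
      f p - f x - dotp (grad f x) (p - x) <= Lt z s / 2 * enorm (p - x) ^+ 2
    & enorm (grad f p - grad f x) <= Lt z s * enorm (p - x)].
Proof.
have [_ [Lbar0 _] _ _ _] := P_ok.
have dx : dom x := dom_pr z; have dp : dom p := dom_pr (z + s).
rewrite /L_trial -/x -/p; have [/eqP|V0] := eqVneq (enorm (p - x)) 0 => /=.
  rewrite enorm_eq0 subr_eq0 => /eqP ->.
  rewrite !subrr enorm0 expr0n/= !mulr0 dotp0r subr0.
  by split => //; [exact: ltW | rewrite lerDr mulr_ge0].
have Vgt0 : 0 < enorm (p - x) by rewrite lt_neqAle eq_sym V0 enorm_ge0.
have U_le := linearization_error_le dx dp.
have W_le := grad_lip_abs dp dx.
set U := f p - f x - _ in U_le *; set W := enorm (grad f p - _) in W_le *.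
have V20 : 0 < enorm (p - x) ^+ 2 by rewrite exprn_gt0.
split.
- by rewrite le_max [X in _ || X]divr_ge0 ?enorm_ge0 ?orbT.
- rewrite ge_max ler_pdivrMr// ler_pdivrMr//; apply/andP; split.
    apply: (@le_trans _ _ (2 * (`|L| * enorm (p - x) ^+ 2))).
      by rewrite ler_pM2l.
    by rewrite mulrA ler_wpM2r ?sqr_ge0// lerDl ltW.
  apply: le_trans W_le _; rewrite ler_wpM2r ?enorm_ge0//.
  by have := normr_ge0 L; lra.
- rewrite mulrAC ler_pdivlMr// mulrC -ler_pdivrMr//.
  by rewrite le_max lexx.
- by rewrite -ler_pdivrMr// le_max lexx orbT.
Qed.

(** The value [0] in the first-order case lets one formula, [stepE], cover both
    kinds of step. *)
Definition correction (k : nat) (z : 'cV[R]_n) (B D : 'M[R]_n) : 'cV[R]_n :=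
  let e := e_dir f phi lambda P k z B D in
  if eta_coef f phi lambda P k z * enorm e <= chi z then e else 0.

Lemma stepE k z B D a : step f phi lambda P k z B D a =
  (a * lambda) *: (- N z + a *: correction k z B D).
Proof.
by rewrite /step /correction; case: ifP => // _; rewrite scaler0 addr0.
Qed.

Lemma correction_bound k z B D :
  eta_coef f phi lambda P k z * enorm (correction k z B D) <= chi z.
Proof.
rewrite /correction; case: ifP => // _.
by rewrite enorm0 mulr0 enorm_ge0.
Qed.

Definition real_merit (tau : R) (z : 'cV[R]_n) : R :=
  f (pr z) + real_value phi (pr z) + tau * lambda / 2 * chi z ^+ 2.

Lemma meritE tau z : merit f phi lambda tau z = (real_merit tau z)%:E.
Proof. by rewrite /merit /objective (domE phi_proper (dom_pr z)) -!EFinD. Qed.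

Lemma normal_map_update z s :
  N (z + s) = N z + (grad f (pr (z + s)) - grad f (pr z)) +
    lambda^-1 *: (s - (pr (z + s) - pr z)).
Proof.
rewrite /normal_map; move: (pr _) (pr _) => y q; move: (grad f _) (grad f _) => a b.
by apply/matrixP => i j; rewrite !mxE; ring.
Qed.

Lemma real_merit_diff tau z s :
  real_merit tau (z + s) - real_merit tau z =
    (f (pr (z + s)) + real_value phi (pr (z + s))
     - f (pr z) - real_value phi (pr z)) +
    tau * lambda / 2 * (chi (z + s) ^+ 2 - chi z ^+ 2).
Proof.
rewrite /real_merit.
move: (f _ : R) (real_value _ _) (chi (z + s)) (f _ : R) (real_value _ _) (chi z).
by move=> a b c d e h; ring.
Qed.

(** The convex part is bounded by the subgradient at the new proximal point,
    the smooth part by the trial Lipschitz estimate. *)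
Lemma objective_diff_le z s (v := pr (z + s) - pr z) :
  f (pr (z + s)) + real_value phi (pr (z + s))
  - f (pr z) - real_value phi (pr z) <=
    dotp (N z) v + lambda^-1 * dotp (s - v) v + Lt z s / 2 * enorm v ^+ 2.
Proof.
have [_ _ hU _] := L_trial_spec z s.
have hsub := prox_subgradient_fine phi_convex phi_lsc phi_proper lambda_gt0
  (z + s) (dom_pr z).
have subgE :
    lambda^-1 *: (z + s - pr (z + s)) = N (z + s) - grad f (pr (z + s)).
  by rewrite /normal_map [RHS]addrC addKr.
have inner (l : R) (u a b w y : 'cV[R]_n) :
    dotp (u + (a - b) + l *: w - a) (- y) =
    - dotp u y + dotp b y - l * dotp w y.
  by rewrite !dotpE; ring.
rewrite subgE normal_map_update -(opprB (pr (z + s)) (pr z)) inner in hsub.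
move: hU hsub; rewrite -/v.
move: (dotp (N z) _) (dotp (s - _) _) (dotp (grad f _) _) (Lt z s / 2 * _)
  (real_value _ _) (real_value _ _) (f _ : R) (f _ : R).
by move=> a b c d e p q r; lra.
Qed.

Lemma ls_testE k tau_prev z B D t
    (s := step f phi lambda P k z B D (rho P ^+ t))
    (tau := tau_trial f phi lambda P k tau_prev z s) :
  ls_test f phi lambda P k tau_prev z B D t <->
  real_merit tau (z + s) - real_merit tau z <=
    - (sigma P * lambda * tau * rho P ^+ t / 2) * chi z ^+ 2
    - nu P k / (lambda * rho P ^+ t) * enorm (pr (z + s) - pr z) ^+ 2.
Proof. by rewrite /ls_test !meritE -EFinB lee_fin. Qed.

(* A bound for all trial Lipschitz estimates, cf. [L_trial_spec]. *)
Let L_max := 2 * `|L| + Lbar P.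

(** A positive lower bound for every parameter tau_k of a run. *)
Definition tau_floor : R :=
  Num.min (2 * gamma P * (1 - nu_max P) / (L_max ^+ 2 * lambda ^+ 2 + 2))
    (tau_init P).

Lemma tau_floor_gt0 : 0 < tau_floor.
Proof.
have [_ [_ ti0] [_ _ /andP[g0 _] /andP[_ nm1]] _ _] := P_ok.
rewrite lt_min ti0 andbT divr_gt0//; first by rewrite !mulr_gt0// subr_gt0.
by rewrite ltr_wpDl// mulr_ge0 ?sqr_ge0.
Qed.

Lemma tau_trial_le k tau_prev z s :
  tau_trial f phi lambda P k tau_prev z s <= tau_prev.
Proof. by rewrite ge_min lexx orbT. Qed.

Lemma tau_floor_le_trial k tau_prev z s : tau_floor <= tau_prev ->
  tau_floor <= tau_trial f phi lambda P k tau_prev z s.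
Proof.
have [_ _ [_ _ /andP[g0 _] /andP[_ nm1]] _ /(_ k)[_ /andP[nu0 num]]] := P_ok.
have [L0 Lm _ _] := L_trial_spec z s => tp.
rewrite le_min tp andbT ge_min; apply/orP; left.
have pos (l : R) : 0 < l ^+ 2 * lambda ^+ 2 + 2.
  by rewrite ltr_wpDl// mulr_ge0 ?sqr_ge0.
apply: ler_pM.
- by rewrite !mulr_ge0 ?subr_ge0// ltW.
- by rewrite invr_ge0 ltW.
- by rewrite ler_pM2l ?mulr_gt0// lerD2l lerN2.
- rewrite lef_pV2 ?posrE// lerD2r ler_wpM2r ?sqr_ge0//.
  by apply: lerXn2r; rewrite ?nnegrE// (le_trans L0).
Qed.

(** The choice of tau_k makes the gradient variation in the merit function cost
    at most the fraction gamma of the decrease 1 - nu_k that the test leaves. *)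
Lemma tau_trial_absorbs k tau_prev z s :
  tau_trial f phi lambda P k tau_prev z s *
    (Lt z s ^+ 2 * lambda ^+ 2 / 2 + 1) <= gamma P * (1 - nu P k).
Proof.
set l := Lt z s.
have pos : 0 < l ^+ 2 * lambda ^+ 2 / 2 + 1.
  by rewrite ltr_wpDl// divr_ge0// mulr_ge0 ?sqr_ge0.
rewrite -ler_pdivlMr// /tau_trial ge_min; apply/orP; left.
rewrite -/l le_eqVlt; apply/orP; left; apply/eqP; field.
by rewrite !gt_eqF//; lra.
Qed.

(** The thresholds can be chosen independently of the iterate because the trial
    Lipschitz estimates are bounded and tau is bounded below along a run. *)
Lemma ls_test_small_step : exists c0 c1 : R, [/\ 0 < c0 <= 1, 0 < c1 &
  forall k tau_prev z B D t, tau_floor <= tau_prev -> rho P ^+ t <= c0 ->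
    rho P ^+ t * enorm (correction k z B D) <= c1 * chi z ->
    ls_test f phi lambda P k tau_prev z B D t].
Proof.
have [_ [Lb0 _] [/andP[sg0 sg1] /andP[rho0 rho1] /andP[g0 g1] /andP[nm0 nm1]] _
  nuP] := P_ok.
have tf0 := tau_floor_gt0.
(* kap bounds the unused decrease (1 - gamma) (1 - nu_k) from below; c0 keeps
   the terms of higher order in the step size below kap / 4, and c1 those that
   involve the correction below (1 - sigma) / 2 of the term in chi. *)
pose kap := (1 - gamma P) * (1 - nu_max P).
have kap0 : 0 < kap by rewrite mulr_gt0// subr_gt0.
have kap1 : kap <= 1 by rewrite /kap; nra.
pose K := lambda * L_max / 2 + 3 / 2 * (L_max ^+ 2 * lambda ^+ 2 + 1).
have Lm0 : 0 <= L_max by rewrite addr_ge0 ?mulr_ge0// ltW.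
have K0 : 0 < K.
  have := mulr_ge0 (ltW lambda_gt0) Lm0.
  have := mulr_ge0 (sqr_ge0 L_max) (sqr_ge0 lambda).
  by rewrite /K; lra.
pose c0 := Num.min 1 (kap / (4 * K)).
pose tf1 := Num.min 1 tau_floor.
have tf10 : 0 < tf1 by rewrite /tf1 lt_min ltr01.
have tf11 : tf1 <= 1 by rewrite /tf1 ge_min lexx.
pose c1 := kap * tf1 * (1 - sigma P) / 10.
have c10 : 0 < c1 by rewrite divr_gt0// !mulr_gt0// subr_gt0.
have kt1 : kap * tf1 <= 1 by rewrite -[leRHS]mulr1 ler_pM// ltW.
have c1s : c1 <= (1 - sigma P) / 10.
  by rewrite /c1 ler_pM2r// ler_piMl// subr_ge0 ltW.
have c11 : c1 <= 1 by lra.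
exists c0, c1; split => //.
  apply/andP; split; last by rewrite /c0 ge_min lexx.
  by rewrite /c0 lt_min ltr01 divr_gt0// mulr_gt0.
move=> k tau_prev z B D t tp ac0 aE.
have [_ /andP[nu0 num]] := nuP k.
apply/ls_testE; rewrite stepE.
set a := rho P ^+ t in ac0 aE *; set e := correction k z B D in aE *.
set s := (a * lambda) *: (- N z + a *: e).
set tau := tau_trial _ _ _ _ _ _ _ _.
have [l lE] : {l | l = Lt z s} by exists (Lt z s).
have [l0 lm hU hW] := L_trial_spec z s; rewrite -lE in l0 lm hU hW.
have htau := tau_trial_absorbs k tau_prev z s; rewrite -/tau -lE in htau.
have tau_lb : tau_floor <= tau by exact: tau_floor_le_trial.
have tau0 : 0 < tau by exact: lt_le_trans tau_lb.
have a0 : 0 < a by rewrite exprn_gt0.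
have ac : a <= 1 by apply: le_trans ac0 _; rewrite /c0 ge_min lexx.
have tau1 : tau <= 1.
  have : 0 <= tau * (l ^+ 2 * lambda ^+ 2).
    by rewrite mulr_ge0 ?mulr_ge0 ?sqr_ge0// ltW.
  have : gamma P * (1 - nu P k) <= 1 by nra.
  lra.
rewrite real_merit_diff [chi (z + s)]/Defs.chi normal_map_update.
apply: (@sufficient_decrease R n lambda tau a (nu P k) (sigma P) kap c1 l) => //.
- by rewrite tau0.
- by rewrite a0.
- by rewrite ltW.
- apply: le_trans htau _; rewrite /kap.
  have : 0 <= (1 - gamma P) * (nu_max P - nu P k).
    by rewrite mulr_ge0 // subr_ge0// ltW.
  lra.
- have aK : a * K <= kap / 4.
    have : a <= kap / (4 * K) by apply: le_trans ac0 _; rewrite /c0 ge_min lexx orbT.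
    by rewrite ler_pdivlMr ?mulr_gt0//; lra.
  apply: le_trans aK; rewrite ler_pM2l// /K.
  have lL2 : l ^+ 2 <= L_max ^+ 2 by apply: lerXn2r; rewrite ?nnegrE.
  have := ler_wpM2l (ltW lambda_gt0) lm.
  have := ler_wpM2r (sqr_ge0 lambda) lL2.
  rewrite -/L_max; lra.
- have -> : c1 ^+ 2 / kap = c1 * (tf1 * (1 - sigma P) / 10).
    by rewrite /c1; field; rewrite gt_eqF.
  have tft : tf1 <= tau by apply: le_trans tau_lb; rewrite /tf1 ge_min lexx orbT.
  have s1 : 0 <= 1 - sigma P by rewrite subr_ge0 ltW.
  have h1 : 0 <= tf1 * (1 - sigma P) by rewrite mulr_ge0// ltW.
  have := ler_wpM2r h1 c11.
  have := ler_wpM2r s1 tft.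
  lra.
- exact: prox_firm.
- by rewrite lE; exact: objective_diff_le.
Qed.

(** The smallest successful exponent is at most one backtracking step below the
    threshold for success, and a second-order step satisfies
    [eta_k |e_k| <= chi (z_k)], so the accepted step size is bounded below by a
    multiple of [min 1 eta_k]. *)
Lemma linesearch_stops : exists c0 c1 : R, [/\ 0 < c0, 0 < c1 &
  forall k tau_prev z B D, tau_floor <= tau_prev -> 0 < chi z ->
    exists2 t, ls_stops_at f phi lambda P k tau_prev z B D t &
      Num.min c0 (c1 * eta_coef f phi lambda P k z) <= rho P ^+ t].
Proof.
have [_ _ [_ /andP[rho0 rho1] _ _] _ _] := P_ok.
have [c0 [c1 [/andP[c00 c01] c10 small]]] := ls_test_small_step.
exists (rho P * c0), (rho P * c1); split; rewrite ?mulr_gt0//.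
move=> k tau_prev z B D tp chi0.
set E := enorm (correction k z B D).
have E0 : 0 <= E := enorm_ge0 _.
pose test t := `[< ls_test f phi lambda P k tau_prev z B D t >].
have ex_test : exists t, test t.
  (* E + 1 in place of E keeps the quotient defined for a zero correction. *)
  pose m := Num.min c0 (c1 * chi z / (E + 1)).
  have m0 : 0 < m by rewrite /m lt_min c00 divr_gt0 ?mulr_gt0 ?ltr_wpDl.
  have /cvg_expr/cvgr_lt/(_ m m0)[t _ /(_ t (leqnn t)) /= rm] : `|rho P| < 1.
    by rewrite gtr0_norm.
  exists t; apply/asboolP; apply: small => //.
    by apply: le_trans (ltW rm) _; rewrite /m ge_min lexx.
  have rm' : rho P ^+ t <= c1 * chi z / (E + 1).
    by apply: le_trans (ltW rm) _; rewrite /m ge_min lexx orbT.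
  apply: le_trans (ler_wpM2r E0 rm') _.
  rewrite mulrAC ler_pdivrMr ?ltr_wpDl// ler_pM2l ?mulr_gt0//.
  by rewrite lerDl.
case: (ex_minnP ex_test) => t /asboolP test_t t_min; exists t.
  split=> // t' t't /asboolP /t_min; by rewrite leqNgt t't.
set eta := eta_coef _ _ _ _ _ _; case: t test_t t_min => [|t] _ t_min.
  rewrite expr0 ge_min; apply/orP; left.
  by rewrite -[leRHS]mulr1 ler_pM// ltW.
have fail_t : ~ ls_test f phi lambda P k tau_prev z B D t.
  by move=> /asboolP/t_min; rewrite ltnn.
rewrite -mulrA -(minr_pMr _ _ (ltW rho0)) exprS ler_pM2l//.
apply: ltW; rewrite ltNge; apply/negP => rm; apply: fail_t.
move: rm; rewrite le_min => /andP[rc0 rc1]; apply: small => //.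
apply: le_trans (ler_wpM2r E0 rc1) _.
by rewrite -mulrA ler_pM2l// correction_bound.
Qed.

(** Replacing tau_{k-1} by the smaller tau_k can only decrease the merit
    function, so the decrease is measured against the previous merit value. *)
Lemma accepted_step_decrease k tau_prev z B D t
    (s := step f phi lambda P k z B D (rho P ^+ t)) :
  tau_floor <= tau_prev -> ls_test f phi lambda P k tau_prev z B D t ->
  real_merit (tau_trial f phi lambda P k tau_prev z s) (z + s) +
    sigma P * lambda * tau_floor / 2 * (rho P ^+ t * chi z ^+ 2) +
    lambda^-1 * (nu P k * enorm (pr (z + s) - pr z) ^+ 2) <=
  real_merit tau_prev z.
Proof.
have [_ _ [/andP[sg0 _] /andP[rho0 rho1] _ _] _ /(_ k)[_ /andP[nu0 _]]] := P_ok.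
move=> tp /ls_testE; rewrite -/s.
have tau_le := tau_trial_le k tau_prev z s.
have tau_ge := tau_floor_le_trial k z s tp.
move: tau_le tau_ge; set tau := tau_trial _ _ _ _ _ _ _ _ => tau_le tau_ge.
have merit_mono : real_merit tau z <= real_merit tau_prev z.
  rewrite lerD2l ler_wpM2r ?sqr_ge0// ler_pM2r ?invr_gt0// ler_pM2r//.
have a0 : 0 < rho P ^+ t by rewrite exprn_gt0.
have a1 : rho P ^+ t <= 1 by rewrite exprn_ile1// ltW.
have chi_part : sigma P * lambda * tau_floor / 2 * (rho P ^+ t * chi z ^+ 2) <=
    sigma P * lambda * tau * rho P ^+ t / 2 * chi z ^+ 2.
  rewrite [leLHS]mulrA ler_wpM2r ?sqr_ge0// mulrAC ler_pM2r ?invr_gt0//.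
  by rewrite ler_pM2r// ler_pM2l// mulr_gt0.
have V_part : lambda^-1 * (nu P k * enorm (pr (z + s) - pr z) ^+ 2) <=
    nu P k / (lambda * rho P ^+ t) * enorm (pr (z + s) - pr z) ^+ 2.
  rewrite mulrA ler_wpM2r ?sqr_ge0// mulrC ler_pM2l//.
  by rewrite lef_pV2 ?posrE ?mulr_gt0// ler_piMr// ltW.
move: merit_mono chi_part V_part.
move: (real_merit tau (z + s)) (real_merit tau z) (real_merit tau_prev z).
move: (lambda^-1 * _) => v; move: (nu P k / _ * _) => v'.
move: (_ * (rho P ^+ t * _)) => x m m' mp; lra.
Qed.

End Linesearch.

(** * Convergence along decreasing sequences *)

Section DecreasingSequences.
Context {R : realType}.

(** Telescoping: the decrements of a nonincreasing sequence bounded below are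
    summable, and each of them dominates [r * a k] and [s * b k]. *)
Lemma decrease_summable (h a b : nat -> R) (c r s : R) :
  0 < r -> 0 < s ->
  (forall k, c <= h k) -> (forall k, 0 <= a k) -> (forall k, 0 <= b k) ->
  (forall k, h k.+1 + r * a k + s * b k <= h k) ->
  a k @[k --> \oo] --> (0 : R) /\ (\sum_(0 <= k <oo) (b k)%:E < +oo)%E.
Proof.
move=> r0 s0 h_ge a0 b0 dec.
have ra0 k : 0 <= r * a k by rewrite mulr_ge0// ltW.
have sb0 k : 0 <= s * b k by rewrite mulr_ge0// ltW.
split.
  have h_decr : {homo h : n m / (n <= m)%N >-> m <= n}.
    apply/nonincreasing_seqP => k; apply: le_trans (dec k).
    by rewrite -addrA lerDl addr_ge0.
  have h_cvg : cvgn h.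
    apply: nonincreasing_is_cvgn => //.
    by exists c => _ [k _ <-].
  have diff_cvg : r^-1 * (h k - h k.+1) @[k --> \oo] --> (0 : R).
    rewrite -(mulr0 r^-1) -(subrr (limn h)).
    apply: cvgM; first exact: cvg_cst.
    by apply: cvgB => //; rewrite (cvg_shiftS h).
  apply: squeeze_cvgr (cvg_cst 0) diff_cvg.
  apply: nearW => k; rewrite a0 /= mulrC ler_pdivlMr// mulrC.
  by have := dec k; have := sb0 k; lra.
have partial N : \sum_(0 <= k < N) s * b k <= h 0%N - h N.
  elim: N => [|N IH]; first by rewrite big_geq// subrr.
  by rewrite big_nat_recr//=; have := dec N; have := ra0 N; lra.
apply: (@le_lt_trans _ _ (s^-1 * (h 0%N - c))%:E); last exact: ltry.
apply: lime_le; first by apply: is_cvg_nneseries => k _ _; rewrite lee_fin.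
apply: nearW => N; rewrite sumEFin lee_fin mulrC ler_pdivlMr// mulrC mulr_sumr.
by apply: le_trans (partial N) _; rewrite lerD2l lerN2.
Qed.

(** [x] cannot stay above a positive level along a subsequence, because there
    the weight in front of its square would be bounded away from zero.  Index 0
    is exempt: the coefficient b_0 of the algorithm vanishes. *)
Lemma cvg0_of_min_weight (x : nat -> R) (m b q : R) (w : nat -> R) :
  0 < m -> 0 < b -> 0 < q -> (forall k, 0 <= x k) ->
  (forall k, (0 < k)%N -> Num.min m (b * x k `^ q) <= w k) ->
  w k * x k ^+ 2 @[k --> \oo] --> (0 : R) ->
  x k @[k --> \oo] --> (0 : R).
Proof.
move=> m0 b0 q0 x0 xw wx; apply/cvgrPdist_lt => e e0.
pose d := Num.min m (b * e `^ q) * e ^+ 2.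
have d1 : 0 < Num.min m (b * e `^ q) by rewrite lt_min m0 mulr_gt0 ?powR_gt0.
have d0 : 0 < d by rewrite mulr_gt0 ?exprn_gt0.
have [N _ hN] := cvgr_lt _ wx _ d0.
exists N.+1 => // k /= Nk; rewrite sub0r normrN ger0_norm// ltNge.
apply/negP => ex; have /= := hN k (ltnW Nk); apply/negP; rewrite -leNgt.
apply: ler_pM; [exact: ltW | exact: sqr_ge0 | |].
  apply: le_trans (xw k (leq_ltn_trans (leq0n N) Nk)).
  rewrite le_min ge_min lexx /= ge_min; apply/orP; right.
  rewrite ler_pM2l//; apply: ge0_ler_powR => //; first exact: ltW.
    by rewrite nnegrE ltW.
  by rewrite nnegrE.
by apply: lerXn2r => //; rewrite nnegrE// ltW.
Qed.

End DecreasingSequences.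

(** * Convergence of the algorithm *)

Theorem theorem3p3 (R : realType) (n : nat)
  (f : 'cV[R]_n -> R^o) (phi : 'cV[R]_n -> \bar R) (L lambda : R)
  (P : alg_params R n)
  (z : nat -> 'cV[R]_n) (B D : nat -> 'M[R]_n) (tau : nat -> R)
  (f_C1 : continuously_differentiable f)
  (phi_convex : econvex_function phi)
  (phi_lsc : lower_semicontinuous phi)
  (phi_proper : proper_function phi)
  (grad_f_lip : elipschitz L (effective_domain phi) (grad f))
  (psi_bounded : exists c : R, forall x,
     dom_subdifferential phi x -> (c%:E <= objective f phi x)%E)
  (lambda_gt0 : 0 < lambda)
  (P_ok : admissible P)
  (z_generated : generated f phi lambda P z B D tau) :
  (exists k, terminates_at f phi lambda z k) \/
  (chi f phi lambda (z k) @[k --> \oo] --> (0 : R) /\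
   (\sum_(0 <= k <oo)
      (nu P k * enorm (prox phi lambda (z k.+1) - prox phi lambda (z k)) ^+ 2)%:E
    < +oo)%E).
Proof.
have [[k0 zk0]|/forallNP run] :=
  pselect (exists k, normal_map f phi lambda (z k) = 0).
  left; have ex0 : exists k, normal_map f phi lambda (z k) == 0.
    by exists k0; apply/eqP.
  case: (ex_minnP ex0) => k /eqP zk k_min; exists k; split => // j jk.
  by apply/negP => /k_min; rewrite leqNgt jk.
right; have [_ _ tau0E gen] := z_generated.
have {}run k : normal_map f phi lambda (z k) != 0 by apply/eqP; exact: run.
have chi_gt0 k : 0 < chi f phi lambda (z k).
  by rewrite lt_neqAle eq_sym enorm_eq0 run enorm_ge0.
have [_ _ [/andP[sg0 _] /andP[rho0 rho1] _ _] [q0 eta0] nuP] := P_ok.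
have [c0 [c1 [c00 c10 stops]]] := linesearch_stops f_C1 phi_convex phi_lsc
  phi_proper grad_f_lip lambda_gt0 P_ok.
set tf := tau_floor L lambda P in stops.
have tf0 : 0 < tf by exact: tau_floor_gt0.
pose H k := real_merit f phi lambda (tau k) (z k).
pose V k := enorm (prox phi lambda (z k.+1) - prox phi lambda (z k)).
have step_k k : tf <= tau k -> [/\ tf <= tau k.+1 &
    exists2 a : R, Num.min c0 (c1 * eta_coef f phi lambda P k (z k)) <= a &
      H k.+1 + sigma P * lambda * tf / 2 * (a * chi f phi lambda (z k) ^+ 2) +
        lambda^-1 * (nu P k * V k ^+ 2) <= H k].
  move=> tfk; have [t stop_t at_] := stops k _ _ (B k) (D k) tfk (chi_gt0 k).
  have [_ _ /(_ t stop_t) [zE tauE]] := gen k (fun j _ => run j).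
  have tf_k1 : tf <= tau k.+1 by rewrite tauE; exact: tau_floor_le_trial.
  split => //; exists (rho P ^+ t) => //.
  rewrite /H /V zE tauE; apply: accepted_step_decrease => //.
  exact: stop_t.1.
have tf_le k : tf <= tau k.
  elim: k => [|k IH]; last by case: (step_k k IH).
  by rewrite tau0E /tf /tau_floor ge_min lexx orbT.
have /choice[a a_spec] k : exists a : R,
    Num.min c0 (c1 * eta_coef f phi lambda P k (z k)) <= a /\
    H k.+1 + sigma P * lambda * tf / 2 * (a * chi f phi lambda (z k) ^+ 2) +
      lambda^-1 * (nu P k * V k ^+ 2) <= H k.
  by have [_ [a a1 a2]] := step_k k (tf_le k); exists a.
have [c psi_ge] := psi_bounded.
have H_ge k : c <= H k.
  have := psi_ge _ (ex_intro _ _ (prox_subgradient phi_convex phi_lsc phi_proper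
    lambda_gt0 (z k))).
  rewrite /objective (domE phi_proper (dom_prox phi_convex phi_lsc phi_proper
    lambda_gt0 (z k))) -EFinD lee_fin => c_le.
  apply: le_trans c_le _; rewrite lerDl mulr_ge0 ?sqr_ge0// divr_ge0// mulr_ge0//.
    exact: le_trans (ltW tf0) (tf_le k).
  exact: ltW.
have a_ge0 k : 0 <= a k.
  apply: le_trans (a_spec k).1; rewrite le_min (ltW c00) mulr_ge0 ?(ltW c10)//.
  by rewrite /eta_coef le_min mulr_ge0 ?powR_ge0 ?(ltW eta0).
have C0 : 0 < sigma P * lambda * tf / 2 by rewrite divr_gt0// !mulr_gt0.
have lambda'0 : 0 < lambda^-1 by rewrite invr_gt0.
have [chi_cvg series_lt] := decrease_summable (h := H)
  (a := fun k => a k * chi f phi lambda (z k) ^+ 2)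
  (b := fun k => nu P k * V k ^+ 2) C0 lambda'0 H_ge
  (fun k => mulr_ge0 (a_ge0 k) (sqr_ge0 _))
  (fun k => mulr_ge0 (ltW (andP (nuP k).2).1) (sqr_ge0 _))
  (fun k => (a_spec k).2).
split => //.
  pose b1 : R := (ln 2 ^+ 2) `^ qexp P.
  have b10 : 0 < b1 by rewrite powR_gt0// exprn_gt0// ln_gt0// ltr1n.
  have m0 : 0 < Num.min c0 (c1 * eta_max P) by rewrite lt_min c00 mulr_gt0.
  apply: (@cvg0_of_min_weight R _ _ (c1 * b1) (qexp P) a m0) => //.
  - by rewrite mulr_gt0.
  - by move=> k; exact: ltW.
  - move=> k k0; apply: le_trans (a_spec k).1.
    (* For k >= 1 the coefficient b_k is at least b_1. *)
    have bk : b1 <= b_coef P k.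
      apply: ge0_ler_powR; rewrite ?nnegrE; [exact: ltW | exact: sqr_ge0 | |].
        by apply: mulr_ge0 => //; exact: sqr_ge0.
      have k1 : (1 : R) <= k%:R by rewrite ler1n.
      rewrite -[leLHS]mul1r; apply: ler_pM; rewrite ?sqr_ge0//.
      apply: lerXn2r; rewrite ?nnegrE ?ln_ge0//; try lra.
      rewrite ler_ln ?posrE//; lra.
    rewrite /eta_coef (minr_pMr _ _ (ltW c10)) !le_min; apply/and3P; split.
    + by rewrite !ge_min lexx.
    + rewrite ge_min; apply/orP; right.
      by rewrite -mulrA ler_pM2l// ler_wpM2r ?powR_ge0.
    + by rewrite !ge_min lexx orbT.
Qed.
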